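(* Let $\rho\in(2,\infty)$, let all costs satisfy $c_x>1$, and let $\mathcal{G}$ be any guessing strategy for $X$ whose induced weights $q_1,\dots,q_{M'}$, $M'=\sum_{i=1}^M\lceil c_i\rceil$, satisfy $$q_{k+1}^{\frac1{1+\rho}}\le\frac1k\left(q_1^{\frac1{1+\rho}}+\dots+q_k^{\frac1{1+\rho}}\right),\qquad k=1,\dots,M'-1 .$$ Then, with $\overline{c}_X(1+\rho)$ the balancing cost at $1+\rho$, $$\mathbb{E}[C_{\mathcal{G}}(X)^\rho]\le\frac{1}{\overline{c}_X(1+\rho)(1+\rho)}\left[\sum_{k=1}^{M'}q_k^{\frac1{1+\rho}}\right]^{1+\rho}+\frac{\rho\,\overline{c}_X(1+\rho)}{2}\,\mathbb{E}[C_{\mathcal{G}}(X)^{\rho-1}]-\frac{\rho(\rho-1)}{2(1+\rho)} .$$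
   Context: $X$ is a random variable on a finite set $\mathcal{X}$ with $|\mathcal{X}|=M$ and distribution $P_X$; each $x\in\mathcal{X}$ has a fixed real cost $c_x$. A guessing strategy is a bijection $\mathcal{G}:\mathcal{X}\to\{1,\dots,M\}$. For a given $\mathcal{G}$ write $p_i=P_X(\mathcal{G}^{-1}(i))$ and $c_i=c_{\mathcal{G}^{-1}(i)}$. The guessing cost is $C_{\mathcal{G}}(x)=\sum_{j=1}^{\mathcal{G}(x)}c_j$, so $\mathbb{E}[C_{\mathcal{G}}(X)^\rho]=\sum_{i=1}^M p_i\left(\sum_{j=1}^i c_j\right)^\rho$. Induced weights: $q_k=p_i$ for $\sum_{l=1}^{i-1}\lceil c_l\rceil<k\le\sum_{l=1}^{i}\lceil c_l\rceil$, $i=1,\dots,M$. Balancing cost: for $\rho>0$, $\overline{c}_X(\rho)$ is a real number (assumed to exist, with all powers well defined) satisfying $\sum_{i=1}^M\left(\sum_{j=1}^{i-1}c_j\right)^\rho p_i=\sum_{i=1}^M\left(\sum_{j=1}^{i}c_j-\overline{c}_X(\rho)\right)^\rho p_i$ (equal to the common cost if all costs are equal). *)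

(* Defs.v *)
From HB Require Import structures.
From mathcomp Require Import all_boot all_order all_algebra.
From mathcomp Require Import reals exp.

Set Implicit Arguments.
Unset Strict Implicit.
Unset Printing Implicit Defensive.

Import Order.TTheory GRing.Theory Num.Theory.

Local Open Scope ring_scope.

(* A bijection between T and the guess positions, bundled with its inverse.
   Positions are 0-based: i : 'I_#|T| is the (i+1)-st guess, so that x is the
   (guess x).+1-th element to be queried. *)
Record guessing (T : finType) := Guessing {
  guess :> T -> 'I_#|T|;
  query : 'I_#|T| -> T;
  guessK : cancel guess query;
  queryK : cancel query guess }.

Definition distribution (R : realType) (T : finType) (P : T -> R) : Prop :=
  (forall x, 0 <= P x) /\ \sum_x P x = 1.

(* E[f(X)] for X with distribution P *)
Definition expect (R : realType) (T : finType) (P f : T -> R) : R :=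
  \sum_x P x * f x.

(* c_1 + ... + c_k, the costs being listed in the order of the guesses *)
Definition cum_cost (R : realType) (T : finType) (c : T -> R)
    (G : guessing T) (k : nat) : R :=
  \sum_(j < #|T| | (j < k)%N) c (query G j).

Definition guessing_cost (R : realType) (T : finType) (c : T -> R)
    (G : guessing T) (x : T) : R :=
  cum_cost c G (G x).+1.

(* The ceiling as a natural number; only meaningful for -1 < x, where the
   integer Num.ceil x is nonnegative. *)
Definition nceil (R : realType) (x : R) : nat := `|Num.ceil x|%N.

Definition cum_ceil (R : realType) (T : finType) (c : T -> R)
    (G : guessing T) (k : nat) : nat :=
  (\sum_(j < #|T| | (j < k)%N) nceil (c (query G j)))%N.

(* Here q k is q_k with 1-based k; only q 1, ..., q (cum_ceil c G #|T|) are
   determined, the other values of q being irrelevant. *)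
Definition induced_weights (R : realType) (T : finType) (P c : T -> R)
    (G : guessing T) (q : nat -> R) : Prop :=
  forall (i : 'I_#|T|) (k : nat),
    (cum_ceil c G i < k <= cum_ceil c G i.+1)%N -> q k = P (query G i).

(* Real powers are taken of nonnegative bases only: powR is total, with junk
   values on negative bases, so the first clause is what makes the balancing
   equation meaningful. *)
Definition balancing_cost (R : realType) (T : finType) (P c : T -> R)
    (G : guessing T) (r cbar : R) : Prop :=
  [/\ forall i : 'I_#|T|, 0 <= cum_cost c G i /\ 0 <= cum_cost c G i.+1 - cbar,
      \sum_(i < #|T|) cum_cost c G i `^ r * P (query G i) =
      \sum_(i < #|T|) (cum_cost c G i.+1 - cbar) `^ r * P (query G i)
    & forall a, (forall x, c x = a) -> cbar = a].

(* Main.v *)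
(* Write r = 1 + rho, b for the balancing cost, S_i and N_i for the cumulative
   costs and rounded-up costs, and Q_k for the k-th partial sum of the
   q_j^(1/r). The hypothesis on q says k q_{k+1}^(1/r) <= Q_k; since
   x |-> (x + u)^r - x^r is nondecreasing, this gives
   q_{k+1} ((k+1)^r - k^r) <= Q_{k+1}^r - Q_k^r. Telescoping over the blocks on
   which q is constant, and rounding down (the same monotonicity), bounds
   Q_{M'}^r below by sum_i p_i (S_i^r - S_{i-1}^r), which by the balancing
   equation is sum_i p_i (S_i^r - (S_i - b)^r). A Taylor expansion with the
   remainder bounded below by its value at S_i = b yields the theorem up to
   replacing b by b^r in the last term, and b >= 1: otherwise
   S_i - b > S_{i-1} for all i, contradicting the balancing equation. *)
Require Import Defs.
From HB Require Import structures.
From mathcomp Require Import all_boot all_order all_algebra.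
From mathcomp Require Import reals exp.
From mathcomp Require Import boolp classical_sets topology normedtype derive realfun.
From mathcomp Require Import ring lra.

Set Implicit Arguments.
Unset Strict Implicit.
Unset Printing Implicit Defensive.

Import Order.TTheory GRing.Theory Num.Theory.
Import numFieldNormedType.Exports.

Local Open Scope ring_scope.

(** * Calculus of real powers *)

(** Only right continuity is asked at 0: the lemma is applied to powers of [y + t] where [y] may be
    0, so differentiability at [t = 0] can fail. *)
Lemma ge0_derive_le (R : realType) (f f' : R -> R) (b : R) :
  0 <= b ->
  (forall x : R, 0 < x -> is_derive x 1 f (f' x)) ->
  (forall x, 0 < x < b -> 0 <= f' x) ->
  (f x @[x --> 0^'+] --> f 0)%classic -> f 0 <= f b.
Proof.
rewrite le_eqVlt => /predU1P[<- //|b0] df f'0 f0.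
have cf (x : R) : 0 < x -> {for x, continuous f}.
  by move=> x0; apply/differentiable_continuous/derivable1_diffP; case: (df x x0).
apply: (@ger0_derive1_le_cc _ f 0 b); rewrite ?in_itv/= ?lexx ?(ltW b0)//.
- by move=> x; rewrite in_itv/= => /andP[x0 _]; case: (df x x0).
- move=> x; rewrite in_itv/= => /andP[x0 xb].
  by rewrite derive1E (@derive_val _ _ _ _ _ _ _ (df x x0)) f'0 ?x0.
apply/(continuous_within_itvP _ b0); split => //.
  by move=> x; rewrite in_itv/= => /andP[x0 _]; exact: cf.
by apply: cvg_at_left_filter; exact: cf.
Qed.

Lemma powRDl_cvg0 (R : realType) (y r : R) : 0 <= y -> 0 < r ->
  ((y + t) `^ r @[t --> 0^'+] --> (y + 0) `^ r)%classic.
Proof.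
rewrite le_eqVlt => /predU1P[<- r0|y0 r0].
  rewrite addr0 powR0 ?gt_eqF//.
  under eq_fun do rewrite add0r.
  exact: powR_cvg0.
apply: cvg_at_right_filter.
apply: (@continuous_comp _ _ _ (fun t => y + t) (fun x => x `^ r)).
  by apply: cvgD; [exact: cvg_cst|exact: cvg_id].
apply/differentiable_continuous/derivable1_diffP/derivable_powR.
by rewrite in_itv/= addr0 y0.
Qed.

Lemma is_derive_powRDl (R : realType) (y r t : R) : 0 <= y -> 0 < t ->
  is_derive t 1 (fun t => (y + t) `^ r) (r * (y + t) `^ (r - 1)).
Proof.
move=> y0 t0; have yt : 0 < y + t by rewrite ltr_wpDl.
have H1 : is_derive t 1 (fun t => y + t) 1.
  have := is_deriveD (is_derive_cst y t 1) (is_derive_id t 1).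
  by rewrite add0r.
have := is_derive1_comp (is_derive1_powR r yt) H1.
by rewrite mulr1.
Qed.

(** The variable is the increment, not the base: in [t], the difference of the two sides has
    derivative [r * ((y + t)]^ (r - 1) - (x + t) [^ (r - 1))], nonnegative as [r - 1 >= 0]. *)
Lemma powRD_increment_le (R : realType) (x y a r : R) :
  0 <= x -> x <= y -> 0 <= a -> 1 <= r ->
  (x + a) `^ r - x `^ r <= (y + a) `^ r - y `^ r.
Proof.
move=> x0 xy a0 r1; have y0 := le_trans x0 xy.
have r0 : 0 < r by lra.
pose f (t : R) := (y + t) `^ r - (x + t) `^ r.
suff : f 0 <= f a by rewrite /f !addr0; lra.
apply: (@ge0_derive_le _ _ (fun t =>
  r * (y + t) `^ (r - 1) - r * (x + t) `^ (r - 1))) => //.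
- by move=> t t0; apply: is_deriveB; exact: is_derive_powRDl.
- move=> t /andP[t0 _]; rewrite subr_ge0 ler_pM2l//.
  by apply: ge0_ler_powR; rewrite ?nnegrE; lra.
- by apply: cvgB; exact: powRDl_cvg0.
Qed.

(* Taylor expansion of [x `^ (1 + rho)] at [y + b] evaluated at [y]; the
   remainder is smallest for [y = 0]. *)
Lemma powR_taylor_remainder (R : realType) (y b rho : R) :
  0 <= y -> 0 <= b -> 2 < rho ->
  (1 + rho) * b * (y + b) `^ rho
    - (1 + rho) * rho / 2 * b ^+ 2 * (y + b) `^ (rho - 1)
    + rho * (rho - 1) / 2 * b `^ (1 + rho)
  <= (y + b) `^ (1 + rho) - y `^ (1 + rho).
Proof.
move=> y0 b0 rho2.
pose f (t : R) := (y + t) `^ (1 + rho) - (1 + rho) * (t * (y + t) `^ rho)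
  + (1 + rho) * rho / 2 * (t ^+ 2 * (y + t) `^ (rho - 1))
  - rho * (rho - 1) / 2 * (0 + t) `^ (1 + rho).
suff : f 0 <= f b.
  rewrite /f !addr0 !add0r powR0 ?gt_eqF//; last by lra.
  by rewrite expr0n/=; lra.
(* The lower-order terms cancel in the derivative; what is left is nonnegative because [rho - 2 > 0]
   and [t <= y + t]. *)
pose f' (t : R) := (1 + rho) * rho * (rho - 1) / 2 *
  (t ^+ 2 * (y + t) `^ (rho - 2) - t `^ rho).
apply: (@ge0_derive_le _ _ f') => //.
- move=> t t0.
  have d1 := @is_derive_powRDl _ y (1 + rho) t y0 t0.
  have d2 := @is_derive_powRDl _ y rho t y0 t0.
  have d3 := @is_derive_powRDl _ y (rho - 1) t y0 t0.
  have d4 := @is_derive_powRDl _ 0 (1 + rho) t (lexx _) t0.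
  apply: is_derive_eq.
  have -> : 1 + rho - 1 = rho by ring.
  have -> : rho - 1 - 1 = rho - 2 by ring.
  by rewrite add0r /f' /GRing.scale /=; field.
- move=> t /andP[t0 _]; apply: mulr_ge0.
    by rewrite !mulr_ge0//; lra.
  have -> : t `^ rho = t ^+ 2 * t `^ (rho - 2).
    by rewrite -powR_mulrn ?ltW// -powRD ?(gt_eqF t0) ?implybT//; congr (_ `^ _); lra.
  rewrite -mulrBr mulr_ge0 ?sqr_ge0// subr_ge0.
  by apply: ge0_ler_powR; rewrite ?nnegrE; lra.
- apply: cvgB; last by apply: cvgM; [exact: cvg_cst|apply: powRDl_cvg0; lra].
  have t0 : (t @[t --> 0^'+] --> (0 : R))%classic.
    by apply: cvg_at_right_filter; exact: cvg_id.
  apply: cvgD.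
    apply: cvgB; first by apply: powRDl_cvg0; lra.
    by apply: cvgM; [exact: cvg_cst|apply: cvgM => //; apply: powRDl_cvg0; lra].
  apply: cvgM; [exact: cvg_cst|apply: cvgM; last by apply: powRDl_cvg0; lra].
  by rewrite expr2; under eq_fun do rewrite expr2; exact: cvgM.
Qed.

(** * Cumulative costs and reindexing by guesses *)

Lemma cum_cost0 (R : realType) (T : finType) (c : T -> R) (G : guessing T) :
  cum_cost c G 0 = 0.
Proof. by rewrite /cum_cost big_pred0. Qed.

Lemma cum_costS (R : realType) (T : finType) (c : T -> R) (G : guessing T)
    (i : 'I_#|T|) :
  cum_cost c G i.+1 = cum_cost c G i + c (query G i).
Proof.
rewrite /cum_cost (bigD1 i) ?ltnSn//= addrC; congr (_ + _).
by apply: eq_bigl => j; rewrite ltnS andbC ltn_neqAle.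
Qed.

Lemma cum_ceil0 (R : realType) (T : finType) (c : T -> R) (G : guessing T) :
  cum_ceil c G 0 = 0%N.
Proof. by rewrite /cum_ceil big_pred0. Qed.

Lemma cum_ceilS (R : realType) (T : finType) (c : T -> R) (G : guessing T)
    (i : 'I_#|T|) :
  cum_ceil c G i.+1 = (cum_ceil c G i + nceil (c (query G i)))%N.
Proof.
rewrite /cum_ceil (bigD1 i) ?ltnSn//= addnC; congr (_ + _)%N.
by apply: eq_bigl => j; rewrite ltnS andbC ltn_neqAle.
Qed.

Lemma leq_cum_ceil (R : realType) (T : finType) (c : T -> R) (G : guessing T)
    (m n : nat) : (m <= n)%N -> (cum_ceil c G m <= cum_ceil c G n)%N.
Proof.
move=> mn; rewrite /cum_ceil [leqRHS](bigID (fun j : 'I__ => j < m)%N)/=.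
apply: leq_trans (leq_addr _ _); rewrite leq_eqVlt; apply/orP; left; apply/eqP.
apply: eq_bigl => j; case: (ltnP j m) => jm; rewrite ?andbF//.
by rewrite (leq_trans jm mn).
Qed.

Lemma le_nceil (R : realType) (x : R) : 0 <= x -> x <= (nceil x)%:R.
Proof.
move=> x0; apply: le_trans (ceil_ge x) _.
by rewrite /nceil natr_absz ler_int ler_norm.
Qed.

Lemma cum_cost_le_ceil (R : realType) (T : finType) (c : T -> R)
    (G : guessing T) (k : nat) :
  (forall x, 0 <= c x) -> cum_cost c G k <= (cum_ceil c G k)%:R.
Proof.
move=> c0; rewrite /cum_cost /cum_ceil natr_sum.
by apply: ler_sum => j _; exact: le_nceil.
Qed.

Lemma sum_query (R : realType) (T : finType) (G : guessing T) (f : T -> R) :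
  \sum_x f x = \sum_(i < #|T|) f (query G i).
Proof.
by apply: reindex; exists G => x _; [exact: queryK|exact: guessK].
Qed.

Lemma expect_guessing_cost (R : realType) (T : finType) (P c : T -> R)
    (G : guessing T) (f : R -> R) :
  expect P (fun x => f (guessing_cost c G x)) =
  \sum_(i < #|T|) P (query G i) * f (cum_cost c G i.+1).
Proof.
rewrite /expect (sum_query G); apply: eq_bigr => i _.
by rewrite /guessing_cost queryK.
Qed.

(** * Inequalities for the weights and the balancing cost *)

(** Increments of the same length [u] are compared at the bases [k%:R * u <= Q]; by homogeneity the
    one at [k%:R * u] is the left-hand side. *)
Lemma powR_sum_increment_ge (R : realType) (q : nat -> R) (r : R) (k : nat) :
  1 <= r -> 0 <= q k.+1 ->
  k%:R * q k.+1 `^ (1 / r) <= \sum_(1 <= j < k.+1) q j `^ (1 / r) ->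
  q k.+1 * (k.+1%:R `^ r - k%:R `^ r) <=
  (\sum_(1 <= j < k.+2) q j `^ (1 / r)) `^ r
  - (\sum_(1 <= j < k.+1) q j `^ (1 / r)) `^ r.
Proof.
move=> r1 qk0; set u := q k.+1 `^ _; set Q := \sum_(1 <= j < k.+1) _ => kuQ.
have r0 : r != 0 by rewrite gt_eqF//; lra.
have u0 : 0 <= u by exact: powR_ge0.
have qE : q k.+1 = u `^ r by rewrite /u -powRrM div1r mulVf// powRr1.
rewrite big_nat_recr//= -/Q -/u qE.
apply: le_trans (powRD_increment_le _ kuQ u0 r1); last by rewrite mulr_ge0.
have -> : k%:R * u + u = k.+1%:R * u by rewrite -natr1 mulrDl mul1r.
by rewrite !powRM// -mulrBl mulrC.
Qed.

Lemma balancing_cost_ge1 (R : realType) (T : finType) (P c : T -> R)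
    (G : guessing T) (r cbar : R) :
  distribution P -> (forall x, 1 < c x) -> 0 < r ->
  balancing_cost P c G r cbar -> 1 <= cbar.
Proof.
move=> [P0 P1] c1 r0 [nneg bal _]; rewrite leNgt; apply/negP => b1.
pose d (i : 'I_#|T|) :=
  (cum_cost c G i.+1 - cbar) `^ r - cum_cost c G i `^ r.
have d0 i : 0 < d i.
  have [ci cSi] := nneg i; rewrite subr_gt0 gt0_ltr_powR ?nnegrE//.
  by rewrite cum_costS; have := c1 (query G i); lra.
(* A vanishing sum of nonnegative terms with every [d i] positive forces all probabilities to be 0,
   against total mass 1. *)
have Pd0 : \sum_(i < #|T|) P (query G i) * d i = 0.
  under eq_bigr do rewrite mulrBr ![P _ * _]mulrC.
  by rewrite sumrB bal subrr.
suff : \sum_x P x = 0 by rewrite P1 => /eqP; rewrite oner_eq0.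
rewrite (sum_query G); apply: big1 => i _.
have Pd_ge0 (j : 'I_#|T|) : true -> 0 <= P (query G j) * d j.
  by move=> _; rewrite mulr_ge0// ltW.
have /eqP := @psumr_eq0P _ _ _ _ Pd_ge0 Pd0 i isT.
by rewrite mulf_eq0 (gt_eqF (d0 i)) orbF => /eqP.
Qed.

Lemma sum_increments_le (R : realType) (T : finType) (P c : T -> R)
    (G : guessing T) (q : nat -> R) (r : R) :
  (forall x, 0 <= P x) -> (forall x, 0 <= c x) -> 1 <= r ->
  induced_weights P c G q ->
  (forall k : nat, (1 <= k < cum_ceil c G #|T|)%N ->
    q k.+1 `^ (1 / r) <= 1 / k%:R * \sum_(1 <= j < k.+1) q j `^ (1 / r)) ->
  \sum_(i < #|T|) P (query G i)
    * (cum_cost c G i.+1 `^ r - cum_cost c G i `^ r) <=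
  (\sum_(1 <= k < (cum_ceil c G #|T|).+1) q k `^ (1 / r)) `^ r.
Proof.
move=> P0 c0 r1 hq hqle; set N := cum_ceil c G.
pose A (k : nat) := (\sum_(1 <= j < k.+1) q j `^ (1 / r)) `^ r.
have A0 : A 0%N = 0 by rewrite /A big_geq// powR0// gt_eqF//; lra.
have S0 (k : nat) : 0 <= cum_cost c G k by apply: sumr_ge0.
have -> : (\sum_(1 <= k < (N #|T|).+1) q k `^ (1 / r)) `^ r =
    A (N #|T|) - A (N 0%N) by rewrite /N cum_ceil0 A0 subr0.
rewrite -(@telescope_sumr _ 0 #|T| (fun i => A (N i)))// big_mkord.
apply: ler_sum => i _.
(* First the base moves from [cum_cost c G i] up to [N i], then the length from the cost up to its
   ceiling. *)
apply: (@le_trans _ _ (P (query G i) * ((N i.+1)%:R `^ r - (N i)%:R `^ r))).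
  apply: ler_wpM2l => //; rewrite cum_costS.
  apply: le_trans (powRD_increment_le (S0 i) (cum_cost_le_ceil G i c0) (c0 _) r1) _.
  rewrite lerD2r ge0_ler_powR ?nnegrE ?addr_ge0//; first lra.
  by rewrite /N cum_ceilS natrD lerD2l le_nceil.
have Nle : (N i <= N i.+1)%N by exact: leq_cum_ceil.
rewrite -(telescope_sumr A Nle).
rewrite -(telescope_sumr (fun k : nat => k%:R `^ r) Nle) mulr_sumr.
(* Weights are 1-based: the step from [k] to [k.+1] carries [q k.+1], which lies in block [i]
   exactly when [N i <= k < N i.+1]. *)
apply: ler_sum_nat => k /andP[ik ki].
have qk : q k.+1 = P (query G i) by apply: hq; rewrite ltnS ik.
rewrite -qk; apply: powR_sum_increment_ge => //; first by rewrite qk.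
(* The hypothesis on [q] starts at [k = 1]; at [k = 0] both sides are 0. *)
case: k ik ki qk => [|k] ik ki qk; first by rewrite mul0r big_geq.
rewrite -ler_pdivlMl// -[k.+1%:R^-1]div1r; apply: hqle => /=.
by apply: leq_trans ki _; apply: leq_cum_ceil.
Qed.

Theorem theorem3p7 (R : realType) (T : finType) (P c : T -> R)
    (G : guessing T) (q : nat -> R) (rho cbar : R)
    (hP : distribution P)
    (hc : forall x, 1 < c x)
    (hrho : 2 < rho)
    (hq : induced_weights P c G q)
    (hqle : forall k : nat, (1 <= k < cum_ceil c G #|T|)%N ->
      q k.+1 `^ (1 / (1 + rho)) <=
      1 / k%:R * \sum_(1 <= j < k.+1) q j `^ (1 / (1 + rho)))
    (hcbar : balancing_cost P c G (1 + rho) cbar) :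
  expect P (fun x => guessing_cost c G x `^ rho) <=
  1 / (cbar * (1 + rho)) *
    (\sum_(1 <= k < (cum_ceil c G #|T|).+1) q k `^ (1 / (1 + rho)))
      `^ (1 + rho)
  + rho * cbar / 2 * expect P (fun x => guessing_cost c G x `^ (rho - 1))
  - rho * (rho - 1) / (2 * (1 + rho)).
Proof.
have [P0 P1] := hP; have r0 : 0 < 1 + rho by lra.
have b1 : 1 <= cbar by exact: (balancing_cost_ge1 hP hc r0 hcbar).
have [nneg bal _] := hcbar.
have c0 x : 0 <= c x by have := hc x; lra.
have r1 : 1 <= 1 + rho by lra.
have := sum_increments_le P0 c0 r1 hq hqle; set Z := _ `^ (1 + rho) => hZ.
have bb : cbar <= cbar `^ (1 + rho) by exact: le1r_powR.
rewrite (@expect_guessing_cost _ _ P c G (fun s => s `^ rho)).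
rewrite (@expect_guessing_cost _ _ P c G (fun s => s `^ (rho - 1))).
set E1 := \sum_(i < _) _; set E2 := \sum_(i < _) _.
(* The goal multiplied by [(1 + rho) * cbar] and rearranged. *)
have : (1 + rho) * cbar * E1 - (1 + rho) * rho / 2 * cbar ^+ 2 * E2
    + rho * (rho - 1) / 2 * cbar <= Z.
  apply: le_trans hZ.
  have -> : \sum_(i < #|T|) P (query G i) *
      (cum_cost c G i.+1 `^ (1 + rho) - cum_cost c G i `^ (1 + rho)) =
    \sum_(i < #|T|) P (query G i) * (cum_cost c G i.+1 `^ (1 + rho)
      - (cum_cost c G i.+1 - cbar) `^ (1 + rho)).
    under eq_bigr do rewrite mulrBr [X in _ - X]mulrC.
    under [RHS]eq_bigr do rewrite mulrBr [X in _ - X]mulrC.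
    by rewrite !sumrB bal.
  (* Total mass 1 spreads the constant over the guesses, so that the bound can be proved term by
     term. *)
  have -> : rho * (rho - 1) / 2 * cbar =
      \sum_(i < #|T|) P (query G i) * (rho * (rho - 1) / 2 * cbar).
    by rewrite -mulr_suml -sum_query P1 mul1r.
  rewrite !mulr_sumr -sumrB -big_split/=.
  apply: ler_sum => i _; have [_ Sb] := nneg i.
  have b0 : 0 <= cbar by lra.
  (* Taken at [y = cum_cost c G i.+1 - cbar], which the balancing condition makes nonnegative. *)
  have := powR_taylor_remainder Sb b0 hrho; rewrite subrK => tay.
  have a0 : 0 <= rho * (rho - 1) / 2 by rewrite !mulr_ge0//; lra.
  have := ler_wpM2l a0 bb => bb'.
  apply: le_trans (ler_wpM2l (P0 (query G i)) (le_trans (lerD (lexx _) bb') tay)).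
  by rewrite le_eqVlt; apply/orP; left; apply/eqP; ring.
have b0 : 0 < cbar by lra.
move=> main; rewrite -(ler_pM2l (mulr_gt0 r0 b0)).
apply: (@le_trans _ _ (Z + (1 + rho) * rho / 2 * cbar ^+ 2 * E2
    - rho * (rho - 1) / 2 * cbar)); first by lra.
rewrite le_eqVlt; apply/orP; left; apply/eqP; field.
by rewrite !gt_eqF.
Qed.
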